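(* For any non-empty set $X$, the free object on $X$ in the category of solutions that are right nilpotent of class at most $2$ is not an injective solution.
   Context: A solution is a pair $(X,r)$ with $X$ a non-empty set and $r\colon X^2\to X^2$ a bijection with $(r\times\mathrm{id})(\mathrm{id}\times r)(r\times\mathrm{id})=(\mathrm{id}\times r)(r\times\mathrm{id})(\mathrm{id}\times r)$, such that, writing $r(x,y)=(\lambda_x(y),\rho_y(x))$, all maps $\lambda_x,\rho_x$ are bijective. A morphism $f\colon(X,r)\to(Y,s)$ is a map with $(f\times f)r=s(f\times f)$. The structure group of $(X,r)$ is $G(X,r)=\langle X\mid x\circ y=u\circ v\text{ whenever } r(x,y)=(u,v)\rangle$; $(X,r)$ is injective if the canonical map $X\to G(X,r)$, $x\mapsto x$, is injective. A solution is right nilpotent of class at most $2$ if, with $W(X)$ the submonoid of $X^X$ generated by all $\lambda_x^{\pm1},\rho_x^{\pm1}$ ($x\in X$) and all maps $D_z\colon x\mapsto\rho_x(z)$ ($z\in X$), one has $\lambda_{m(\lambda_x^{\alpha}(y))}=\lambda_{m(y)}$ for all $x,y\in X$, $\alpha\in\{\pm1\}$ and $m\in W(X)$; equivalently, if $\lambda_{\lambda_x(y)}=\lambda_y$ for all $x,y\in X$. The free object on $X$ in the category of such solutions is a member $F$ with a map $i\colon X\to F$ such that each map from $X$ to a member $K$ factors as $\varphi\circ i$ for a unique morphism $\varphi\colon F\to K$; it exists. *)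

(* Defs.v *)
From HB Require Import structures.
From mathcomp Require Import all_boot.
From mathcomp Require Import boolp.

Set Implicit Arguments.
Unset Strict Implicit.
Unset Printing Implicit Defensive.

Local Open Scope quotient_scope.

Section YangBaxter.
Variables (X : Type) (r : X * X -> X * X).

(* r x id and id x r on X^3 = (X * X) * X *)
Definition apply12 (t : X * X * X) : X * X * X := (r t.1, t.2).
Definition apply23 (t : X * X * X) : X * X * X :=
  (t.1.1, (r (t.1.2, t.2)).1, (r (t.1.2, t.2)).2).

Definition yang_baxter : Prop :=
  apply12 \o apply23 \o apply12 =1 apply23 \o apply12 \o apply23.

(* r (x, y) = (lambda_x y, rho_y x): the subscript is the first argument of
   both maps below. *)
Definition lambda_of (x y : X) : X := (r (x, y)).1.
Definition rho_of (y x : X) : X := (r (x, y)).2.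
End YangBaxter.

Record solution : Type := Solution {
  carrier :> Type;
  rmap : carrier * carrier -> carrier * carrier;
  solution_nonempty : inhabited carrier;
  rmap_bij : bijective rmap;
  rmap_yb : yang_baxter rmap;
  lambda_bij : forall x, bijective (lambda_of rmap x);
  rho_bij : forall x, bijective (rho_of rmap x) }.

Arguments rmap : clear implicits.

Definition lambda (S : solution) : S -> S -> S := lambda_of (rmap S).
Definition rho (S : solution) : S -> S -> S := rho_of (rmap S).

Definition is_morphism (S T : solution) (f : S -> T) : Prop :=
  forall p : S * S,
    (f (rmap S p).1, f (rmap S p).2) = rmap T (f p.1, f p.2).

Definition inverse_maps (T : Type) (f g : T -> T) : Prop :=
  cancel f g /\ cancel g f.

(* is_pm1_power f g : g = f^alpha for some alpha in {1, -1} *)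
Definition is_pm1_power (T : Type) (f g : T -> T) : Prop :=
  g = f \/ inverse_maps f g.

Inductive in_W (S : solution) : (S -> S) -> Prop :=
| W_id : in_W (fun x => x)
| W_comp m n : in_W m -> in_W n -> in_W (m \o n)
| W_lambda x m : is_pm1_power (lambda x) m -> in_W m
| W_rho x m : is_pm1_power (rho x) m -> in_W m
| W_D z : in_W (fun x => rho x z).

Definition right_nilpotent2 (S : solution) : Prop :=
  forall (x y : S) (f m : S -> S), is_pm1_power (lambda x) f -> in_W m ->
    lambda (m (f y)) =1 lambda (m y).

Section StructureGroup.
Variable S : solution.

(* Group words in the generators S: (x, false) is the letter x and (x, true)
   the letter x^-1. The type {classic S} is S with a choiceType structure. *)
Definition word : Type := seq ({classic S} * bool).
HB.instance Definition _ := Choice.on word.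

Definition letter (x : S) : {classic S} * bool := (x, false).

Definition inv_word (w : word) : word := rev [seq (l.1, ~~ l.2) | l <- w].

Inductive word_eq : word -> word -> Prop :=
| weq_refl w : word_eq w w
| weq_sym v w : word_eq v w -> word_eq w v
| weq_trans u v w : word_eq u v -> word_eq v w -> word_eq u w
| weq_cat v v' w w' : word_eq v v' -> word_eq w w' ->
    word_eq (v ++ w) (v' ++ w')
| weq_cancel (x : {classic S}) b : word_eq [:: (x, b); (x, ~~ b)] [::]
| weq_rel x y u v : rmap S (x, y) = (u, v) ->
    word_eq [:: letter x; letter y] [:: letter u; letter v].

Definition word_eqb : rel word := fun v w => `[< word_eq v w >].

Lemma word_eqb_refl : reflexive word_eqb.
Proof. by move=> w; apply/asboolP; exact: weq_refl. Qed.

Lemma word_eqb_sym : symmetric word_eqb.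
Proof. by move=> v w; apply/asboolP/asboolP; exact: weq_sym. Qed.

Lemma word_eqb_trans : transitive word_eqb.
Proof.
by move=> v u w /asboolP uv /asboolP vw; apply/asboolP; exact: weq_trans uv vw.
Qed.

Canonical word_equiv : equiv_rel word :=
  EquivRel word_eqb word_eqb_refl word_eqb_sym word_eqb_trans.

Definition structure_group := {eq_quot word_equiv}.
HB.instance Definition _ := Choice.on structure_group.

Definition class_of_word (w : word) : structure_group := \pi w.

Lemma class_of_wordP v w :
  word_eq v w <-> class_of_word v = class_of_word w.
Proof.
split; first by move=> vw; apply/eqmodP; apply/asboolP.
by move=> /eqmodP/asboolP.
Qed.

Lemma word_eq_repr w : word_eq (repr (class_of_word w)) w.
Proof. by apply/class_of_wordP; rewrite /class_of_word reprK. Qed.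

Lemma word_eq_mulVw w : word_eq (inv_word w ++ w) [::].
Proof.
elim: w => [|[x b] w IHw]; first exact: weq_refl.
rewrite /inv_word /= rev_cons -cats1 -catA.
apply: (@weq_trans _ (inv_word w ++ w)) => //.
apply: weq_cat; first exact: weq_refl.
apply: (@weq_cat [:: (x, ~~ b); (x, b)] [::] w w); last exact: weq_refl.
by have := weq_cancel x (~~ b); rewrite negbK.
Qed.

Lemma inv_wordK : involutive inv_word.
Proof.
move=> w; rewrite /inv_word map_rev revK -map_comp -[RHS]map_id.
by apply: eq_map => -[x b] /=; rewrite negbK.
Qed.

Lemma word_eq_mulwV w : word_eq (w ++ inv_word w) [::].
Proof. by rewrite -{1}[w]inv_wordK; exact: word_eq_mulVw. Qed.

Lemma word_eq_inv v w : word_eq v w -> word_eq (inv_word v) (inv_word w).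
Proof.
move=> vw; apply: (@weq_trans _ (inv_word v ++ (w ++ inv_word w))).
  rewrite -{1}[inv_word v]cats0; apply: weq_cat; first exact: weq_refl.
  by apply: weq_sym; exact: word_eq_mulwV.
rewrite catA -[X in word_eq _ X]cat0s; apply: weq_cat; last exact: weq_refl.
apply: (@weq_trans _ (inv_word v ++ v)); last exact: word_eq_mulVw.
by apply: weq_cat; [exact: weq_refl | exact: weq_sym].
Qed.

Definition sg_one : structure_group := class_of_word [::].
Definition sg_mul (g h : structure_group) : structure_group :=
  class_of_word (repr g ++ repr h).
Definition sg_inv (g : structure_group) : structure_group :=
  class_of_word (inv_word (repr g)).

Lemma sg_mulE v w :
  sg_mul (class_of_word v) (class_of_word w) = class_of_word (v ++ w).
Proof. by apply/class_of_wordP; apply: weq_cat; exact: word_eq_repr. Qed.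

Lemma sg_invE w : sg_inv (class_of_word w) = class_of_word (inv_word w).
Proof. by apply/class_of_wordP/word_eq_inv/word_eq_repr. Qed.

Lemma sg_ind (P : structure_group -> Prop) :
  (forall w, P (class_of_word w)) -> forall g, P g.
Proof. by move=> Pw g; rewrite -[g]reprK; exact: Pw. Qed.

Lemma sg_mulA : associative sg_mul.
Proof.
elim/sg_ind=> u; elim/sg_ind=> v; elim/sg_ind=> w.
by rewrite !sg_mulE catA.
Qed.

Lemma sg_mul1 : left_id sg_one sg_mul.
Proof. by elim/sg_ind=> w; rewrite sg_mulE. Qed.

Lemma sg_mulr1 : right_id sg_one sg_mul.
Proof. by elim/sg_ind=> w; rewrite sg_mulE cats0. Qed.

Lemma sg_mulV : left_inverse sg_one sg_inv sg_mul.
Proof.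
elim/sg_ind=> w; rewrite sg_invE sg_mulE.
by apply/class_of_wordP; exact: word_eq_mulVw.
Qed.

Lemma sg_mulrV : right_inverse sg_one sg_inv sg_mul.
Proof.
elim/sg_ind=> w; rewrite sg_invE sg_mulE.
by apply/class_of_wordP; exact: word_eq_mulwV.
Qed.

HB.instance Definition _ := isGroup.Build structure_group
  sg_mulA sg_mul1 sg_mulr1 sg_mulV sg_mulrV.

Definition structure_gen (x : S) : structure_group :=
  class_of_word [:: letter x].

End StructureGroup.

Definition injective_solution (S : solution) : Prop :=
  injective (@structure_gen S).

Definition free_right_nilpotent2 (X : Type) (F : solution) (i : X -> F) : Prop :=
  right_nilpotent2 F /\
  forall (K : solution) (g : X -> K), right_nilpotent2 K ->
    exists! phi : F -> K, is_morphism phi /\ phi \o i =1 g.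

(* Main.v *)
From mathcomp Require Import all_boot.
Require Import Defs.

(** In the structure group of any solution, applying the defining relation to
    x and y = lambda_x^-1 x and cancelling x gives y = rho_y x. Injectivity
    would lift this identity to the solution itself, and morphisms transport it.
    It fails in the solution r (x, y) = (y, ~~ x) on booleans, whose maps
    lambda_x are all the identity, so that it is right nilpotent of class at
    most 2. *)

Lemma structure_gen_rho_fix (S : solution) (x y : S) :
  lambda x y = x -> structure_gen (rho y x) = structure_gen y.
Proof.
move=> lxy.
have rel : rmap S (x, y) = (x, rho y x).
  by rewrite [LHS]surjective_pairing -[X in (_, _) = (X, _)]lxy.
have := weq_rel rel.
(* Splitting both words into letters turns the relation into a product equality in the group, with
   common left factor x. *)
rewrite -[[:: _; letter y]]cat1s -[[:: _; letter (rho y x)]]cat1s.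
move/class_of_wordP; rewrite -!sg_mulE => eq_xy.
exact/esym/(mulgI (structure_gen x)).
Qed.

(** A permutation solution (f y, g x) with f = id and g = [negb], which commute; [negb] has no fixed
    point. *)
Definition flip_map (p : bool * bool) : bool * bool := (p.2, ~~ p.1).

Lemma flip_map_bij : bijective flip_map.
Proof. by exists (fun p => (~~ p.2, p.1)) => -[[] []]. Qed.

Lemma flip_map_yb : yang_baxter flip_map.
Proof. by case=> [[[] []] []]. Qed.

Lemma flip_lambda_bij x : bijective (lambda_of flip_map x).
Proof. by exists id. Qed.

Lemma flip_rho_bij x : bijective (rho_of flip_map x).
Proof. by exists negb => -[]. Qed.

Definition flip_solution : solution :=
  Solution (inhabits true) flip_map_bij flip_map_yb flip_lambda_bij flip_rho_bij.

Lemma flip_right_nilpotent2 : right_nilpotent2 flip_solution.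
Proof. by []. Qed.

Theorem corollary5p10 (X : Type) (hX : inhabited X) (F : solution) (i : X -> F)
    (hF : free_right_nilpotent2 i) :
  ~ injective_solution F.
Proof.
move=> injF; case: hX => x0.
(* The value [true] is arbitrary. *)
have [_ /(_ flip_solution (fun=> true) flip_right_nilpotent2)] := hF.
case=> phi [[phiM _] _].
have [linv _ lK] := lambda_bij (i x0).
set x := i x0 in linv lK; set y := linv x.
have lxy : lambda x y = x := lK x.
have rxy : rho y x = y := injF _ _ (structure_gen_rho_fix _ _ _ lxy).
have := phiM (x, y).
rewrite -/(lambda_of _ x y) -/(rho_of _ y x) -/(lambda x y) -/(rho y x) lxy rxy.
(* The equation is (phi x, phi y) = (phi y, ~~ phi x), hence phi y = ~~ phi y. *)
by rewrite /= /flip_map /= => -[->]; case: (phi y).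
Qed.
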